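(* Let $f$ be a real polynomial of degree $d\ge1$ in $n$ variables and let $\mathcal P=\{x\in\mathbb R^n:\langle a_i,x\rangle\le b_i\ (i=1,\ldots,m),\ \langle p_j,x\rangle=q_j\ (j=1,\ldots,r)\}$ be nonempty, with $f$ bounded below on $\mathcal P$. Let $(g,h)$ be either the termwise power-sum-DC components $(g_1,h_1)$ of $f$ or the homogenizing-dehomogenizing power-sum-DC components $(g_2,h_2)$ of $f$ (both described in the context). Let $y^k$ and $d^k$ be generated at some iteration $k$ of the BDCA$_{\mathrm e}$ algorithm (described in the context) with these components, and let $$\bar t=\min_{i\in\mathcal I(d^k)}\frac{b_i-\langle a_i,y^k\rangle}{\langle a_i,d^k\rangle},\qquad \mathcal I(d^k)=\{i\in\{1,\ldots,m\}:\langle a_i,d^k\rangle>0\},$$ with the convention $\min\emptyset=\infty$. Then $d^k\in\mathcal D(y^k)$ is equivalent to $\bar t>0$. Moreover, if $t\in[0,\bar t]$ ($t\in[0,\infty)$ when $\bar t=\infty$), then $y^k+td^k\in\mathcal P$, and if $t>\bar t$, then $y^k+td^k\notin\mathcal P$.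
   Context: Here $a_i,p_j\in\mathbb R^n$, $b_i,q_j\in\mathbb R$, and $\mathcal P$ need not be bounded. The cone of feasible directions of $\mathcal P$ at $\bar y\in\mathcal P$ is $\mathcal D(\bar y)=\{v\in\mathbb R^n:\exists\,\delta>0\text{ such that }\bar y+tv\in\mathcal P\ \forall t\in[0,\delta]\}$. Power-sum representation. For positive integers $N,D$ let $\mathcal I_{N,D}=\{\alpha\in\mathbb N^N:\alpha_1+\cdots+\alpha_N=D\}$ (with $0\in\mathbb N$), whose elements are listed as $\alpha^1,\ldots,\alpha^s$ with $s=\binom{N+D-1}{D}$. The power-product matrix $\widehat V(N,D)$ is the nonsingular $s\times s$ matrix with $(i,j)$ entry $\binom{D}{\alpha^j}(\alpha^i)^{\alpha^j}$, where $\binom{D}{\alpha}=\frac{D!}{\alpha_1!\cdots\alpha_N!}$ and $(\alpha^i)^{\alpha^j}=\prod_l(\alpha^i_l)^{\alpha^j_l}$ (with $0^0=1$). A form $\varphi(z)=\sum_{\alpha\in\mathcal I_{N,D}}c_\alpha z^\alpha$ in $N$ variables of degree $D$ can be written as $\varphi(z)=\sum_{\alpha\in\mathcal I_{N,D}}\lambda_\alpha\langle\alpha,z\rangle^D$, where $\lambda$ is the unique solution of $\widehat V(N,D)^\top\lambda=c$. If $D$ is even, put $\varphi^+(z)=\sum_{\lambda_\alpha>0}\lambda_\alpha\langle\alpha,z\rangle^D$ and $\varphi^-(z)=\sum_{\lambda_\alpha<0}(-\lambda_\alpha)\langle\alpha,z\rangle^D$, so that $\varphi=\varphi^+-\varphi^-$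 with $\varphi^\pm$ convex. Termwise power-sum-DC components: write $f=\sum_{k=0}^df_k$ with $f_k$ a form of degree $k$. For $k\ge1$ even, set $G_k(x)=f_k^+(x)$, $H_k(x)=f_k^-(x)$. For $k$ odd, apply the splitting to the form $\varphi(x,x_h)=x_hf_k(x)$ of degree $k+1$ in $n+1$ variables and set $G_k(x)=\varphi^+(x,1)$, $H_k(x)=\varphi^-(x,1)$. Then $g_1=\sum_{k=1}^dG_k$ and $h_1=\sum_{k=1}^dH_k$, and $f=g_1-h_1$ up to the constant term $f_0$. Collecting terms, $g_1$ and $h_1$ have the form $\sum_{p=1}^{\lceil d/2\rceil}\|A_px+b_p\|_{2p}^{2p}$, where $\|\cdot\|_{2p}$ is the $\ell_{2p}$ norm. Homogenizing-dehomogenizing power-sum-DC components: let $d_f=2\lceil d/2\rceil$ and let $f_H(x,x_h)=x_h^{d_f}f(x_1/x_h,\ldots,x_n/x_h)$, a form of degree $d_f$ in $n+1$ variables. Then $g_2(x)=f_H^+(x,1)$, $h_2(x)=f_H^-(x,1)$, so $f=g_2-h_2$. Both are of the form $\|Ax+b\|_{d_f}^{d_f}$. BDCA$_{\mathrm e}$ algorithm for $\min_{x\in\mathcal P}f(x)$: start from $x^0\in\mathcal P$ and a tolerance $\varepsilon>0$. For $k=0,1,\ldots$: (1) choose $y^k\in\operatorname{argmin}_{x\in\mathcal P}\{g(x)-\langle\nabla h(x^k),x\rangle\}$; (2) set $d^k=y^k-x^k$ and, if $\|d^k\|/(1+\|x^k\|)<\varepsilon$ (Euclidean norm), stop and return $x^k$;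 (3) compute $\mathcal I(d^k)$ and $\bar t$ by the formulas in the claim; (4) if $\bar t>0$, let $t_k$ be a (finite) minimizer of $t\mapsto f(y^k+td^k)$ over $0\le t\le\bar t$ (over $t\ge0$ if $\bar t=\infty$); otherwise set $t_k=0$; (5) set $x^{k+1}=y^k+t_kd^k$. *)

(* Defs.v *)
(* mpoly must be imported before the mathcomp-classical and mathcomp-reals
   files: the other order makes their notation levels clash. *)
From mathcomp Require Import all_boot all_order all_algebra.
From mathcomp Require Import mpoly.
From mathcomp Require Import classical_sets reals constructive_ereal.

Set Implicit Arguments.
Unset Strict Implicit.
Unset Printing Implicit Defensive.

Import Order.TTheory GRing.Theory Num.Theory.

Local Open Scope classical_set_scope.
Local Open Scope ring_scope.

Section Euclidean.
Variables (R : realType) (n : nat).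

Definition dot (u v : 'rV[R]_n) : R := \sum_(i < n) u 0 i * v 0 i.

(* The norm that the library puts on matrices is the max norm. *)
Definition norm2 (u : 'rV[R]_n) : R := Num.sqrt (dot u u).

Definition peval (p : {mpoly R[n]}) (x : 'rV[R]_n) : R := p.@[x 0].

Definition grad (p : {mpoly R[n]}) (x : 'rV[R]_n) : 'rV[R]_n :=
  \row_(i < n) peval p^`M(i) x.

End Euclidean.

Section PowerSum.
Variables (R : realType) (N D : nat).

(* The exponents of total degree D; the bound on the type only serves to make
   it finite. *)
Definition expo : {set 'X_{1..N < D.+1}} :=
  [set m : 'X_{1..N < D.+1} | mdeg (bmnm m) == D].

(* The listing alpha^1, ..., alpha^s of the exponents. *)
Definition alpha (i : 'I_#|expo|) : 'X_{1..N} := bmnm (enum_val i).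

Definition multinomial (m : 'X_{1..N}) : R :=
  D`!%:R / (\prod_(l < N) (m l)`!)%:R.

Definition power_product : 'M[R]_#|expo| :=
  \matrix_(i, j) (multinomial (alpha j) *
                  \prod_(l < N) (alpha i l)%:R ^+ (alpha j l)).

Lemma multinomial_neq0 (m : 'X_{1..N}) : multinomial m != 0.
Proof.
rewrite /multinomial mulf_neq0 ?invr_eq0 ?pnatr_eq0 -?lt0n ?fact_gt0 //.
by rewrite prodn_gt0 // => l; rewrite fact_gt0.
Qed.

Lemma mdeg_alpha (i : 'I_#|expo|) : mdeg (alpha i) = D.
Proof. by have := enum_valP i; rewrite inE => /eqP. Qed.

Lemma alpha_inj : injective alpha.
Proof. by move=> i j /val_inj /enum_val_inj. Qed.

Lemma meval_form (phi : {mpoly R[N]}) (v : 'I_N -> R) :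
  phi \is D.-homog ->
  phi.@[v] = \sum_i phi@_(alpha i) * \prod_(l < N) v l ^+ alpha i l.
Proof.
move=> hphi.
have szphi : (msize phi <= D.+1)%N.
  by rewrite msizeE big_seq; apply/bigmax_leqP_seq => m m_phi _;
     rewrite (dhomog_mf hphi m_phi).
rewrite {1}(mpolywE szphi) raddf_sum /=.
rewrite (bigID (fun m => m \in expo)) /= [X in _ + X]big1 ?addr0; last first.
  move=> m; rewrite inE => mD.
  by rewrite mevalZ (dhomog_nemf_coeff hphi) ?mul0r.
rewrite big_enum_val.
by apply: eq_bigr => i _; rewrite mevalZ mevalX.
Qed.

(* The form prod_l prod_(k < beta_l) (z_l - k/D * (z_1 + ... + z_N)), whose
   degree is |beta|. For |beta| = D its only non-root among the exponents of
   degree D is beta. *)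
Definition dual_form (beta : 'X_{1..N}) : {mpoly R[N]} :=
  \prod_(l < N) \prod_(k < beta l)
    ('X_l - (k%:R / D%:R) *: \sum_(i < N) 'X_i).

Lemma dual_form_homog beta : dual_form beta \is (mdeg beta).-homog.
Proof.
have prod_homog (I : finType) (F : I -> {mpoly R[N]}) (e : I -> nat) :
  (forall i, F i \is (e i).-homog) -> \prod_i F i \is (\sum_i e i).-homog.
  move=> H; elim/big_rec2: _ => [|i k s _ IH]; first exact: dhomog1.
  exact: dhomogM.
rewrite mdegE; apply: (prod_homog _ _ (fun l => beta l)) => l.
suff : \prod_(k < beta l) ('X_l - (k%:R / D%:R : R) *: \sum_(i < N) 'X_i)
    \is (\sum_(k < beta l) 1)%N.-homog by rewrite sum1_card card_ord.
apply: (prod_homog _ _ (fun=> 1%N)) => k.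
by rewrite rpredB ?rpredZ ?rpred_sum // => *; rewrite dhomogX /= mdeg1.
Qed.

Lemma meval_dual_form (i j : 'I_#|expo|) :
  (dual_form (alpha j)).@[fun l => (alpha i l)%:R] =
    (\prod_(l < N) (alpha j l)`!)%:R *+ (i == j).
Proof.
rewrite rmorph_prod /=.
have -> : \prod_(l < N) (\prod_(k < alpha j l)
      ('X_l - (k%:R / D%:R) *: \sum_(i < N) 'X_i)).@[fun l => (alpha i l)%:R]
    = \prod_(l < N) \prod_(k < alpha j l) ((alpha i l)%:R - k%:R) :> R.
  apply: eq_bigr => l _; rewrite rmorph_prod /=; apply: eq_bigr => k _.
  rewrite mevalB mevalZ raddf_sum /= mevalXU; congr (_ - _).
  rewrite (eq_bigr (fun l => (alpha i l)%:R)) => [|l' _]; last by rewrite mevalXU.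
  rewrite -natr_sum -mdegE mdeg_alpha divfK // pnatr_eq0.
  by rewrite -(mdeg_alpha j) mdegE (bigD1 l) //=; case: (alpha j l) k => [[]|].
have [->|neq] := eqVneq i j.
  rewrite mulr1n natr_prod; apply: eq_bigr => l _.
  rewrite -ffactnn ffact_prod natr_prod; apply: eq_bigr => k _.
  by rewrite natrB // ltnW.
have [l lt_l] : exists l, (alpha i l < alpha j l)%N.
  apply/existsP; apply: contraNT neq; rewrite negb_exists => /forallP H.
  have le_ji l : (alpha j l <= alpha i l)%N by rewrite leqNgt.
  apply/eqP/alpha_inj/mnmP => l.
  have [_ ] := leqif_sum (I := 'I_N) (P := predT)
    (fun l _ => leqif_eq (le_ji l)).
  rewrite -!mdegE !mdeg_alpha eqxx => /esym/forallP /(_ l) /=.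
  by move=> /eqP.
rewrite mulr0n (bigD1 l) //= (bigD1 (Ordinal lt_l)) //= subrr.
by rewrite !mul0r.
Qed.

Lemma power_product_unit : power_product \in unitmx.
Proof.
pose W : 'M[R]_#|expo| := \matrix_(j, k)
  ((dual_form (alpha k))@_(alpha j) / multinomial (alpha j)
   / (\prod_(l < N) (alpha k l)`!)%:R).
suff /mulmx1_unit[] : power_product *m W = 1%:M by [].
apply/matrixP => i k; rewrite !mxE.
have fact_neq0 : (\prod_(l < N) (alpha k l)`!)%:R != 0 :> R.
  by rewrite pnatr_eq0 -lt0n prodn_gt0 // => l; rewrite fact_gt0.
apply: (mulIf fact_neq0).
rewrite mulrnAl mul1r -meval_dual_form meval_form; last first.
  by have := dual_form_homog (alpha k); rewrite mdeg_alpha.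
rewrite mulr_suml; apply: eq_bigr => j _; rewrite !mxE.
rewrite -[LHS]mulrA divfK // [X in X * _]mulrC mulrACA divff ?multinomial_neq0 //.
by rewrite mulr1 mulrC.
Qed.

Definition form_coef (phi : {mpoly R[N]}) : 'cV[R]_#|expo| :=
  \col_j phi@_(alpha j).

(* The inverse exists by power_product_unit. *)
Definition psum_coef (phi : {mpoly R[N]}) : 'cV[R]_#|expo| :=
  invmx power_product^T *m form_coef phi.

Definition linear_form (m : 'X_{1..N}) : {mpoly R[N]} :=
  \sum_(l < N) (m l)%:R *: 'X_l.

Definition psum_pos (phi : {mpoly R[N]}) : {mpoly R[N]} :=
  \sum_(i | 0 < psum_coef phi i 0)
     psum_coef phi i 0 *: linear_form (alpha i) ^+ D.

Definition psum_neg (phi : {mpoly R[N]}) : {mpoly R[N]} :=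
  \sum_(i | psum_coef phi i 0 < 0)
     (- psum_coef phi i 0) *: linear_form (alpha i) ^+ D.

End PowerSum.

Section Components.
Variables (R : realType) (n : nat).

(* In n.+1 variables the last one, ord_max, is the homogenizing one; mwiden
   embeds the polynomials in the first n variables. *)
Definition hvar : {mpoly R[n.+1]} := 'X_ord_max.

Definition dehomogenize (p : {mpoly R[n.+1]}) : {mpoly R[n]} :=
  p \mPo [tuple (if unlift ord_max i is Some j then 'X_j else 1) | i < n.+1].

Definition hpart (k : nat) (f : {mpoly R[n]}) : {mpoly R[n]} :=
  pihomog mdeg k f.

Definition term_pos (k : nat) (f : {mpoly R[n]}) : {mpoly R[n]} :=
  if odd k then dehomogenize (psum_pos k.+1 (hvar * mwiden (hpart k f)))
  else psum_pos k (hpart k f).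

Definition term_neg (k : nat) (f : {mpoly R[n]}) : {mpoly R[n]} :=
  if odd k then dehomogenize (psum_neg k.+1 (hvar * mwiden (hpart k f)))
  else psum_neg k (hpart k f).

(* In the definitions below d stands for the degree of f. *)
Definition termwise_g (d : nat) (f : {mpoly R[n]}) : {mpoly R[n]} :=
  \sum_(1 <= k < d.+1) term_pos k f.

Definition termwise_h (d : nat) (f : {mpoly R[n]}) : {mpoly R[n]} :=
  \sum_(1 <= k < d.+1) term_neg k f.

(* 2 * ceil (d / 2) *)
Definition even_deg (d : nat) : nat := (uphalf d).*2.

(* x_h ^ e * f (x_1 / x_h, ..., x_n / x_h) for e at least the degree of f, see
   homogenizeE. *)
Definition homogenize (e : nat) (f : {mpoly R[n]}) : {mpoly R[n.+1]} :=
  \sum_(m <- msupp f) f@_m *: (hvar ^+ (e - mdeg m) * mwiden 'X_[m]).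

Lemma homogenizeE (e : nat) (f : {mpoly R[n]}) (v : 'I_n.+1 -> R) :
  (msize f <= e.+1)%N -> v ord_max != 0 ->
  (homogenize e f).@[v] =
    v ord_max ^+ e *
      f.@[fun i => v (widen_ord (leqnSn n) i) / v ord_max].
Proof.
move=> sz_f vn0; rewrite raddf_sum /= [in RHS]mevalE mulr_sumr big_seq [RHS]big_seq.
apply: eq_bigr => m m_f; rewrite mevalZ mwidenX mevalM rmorphXn /= mevalXU [RHS]mulrCA.
congr (_ * _).
have le_me : (mdeg m <= e)%N.
  by have := msize_mdeg_lt m_f => /leq_trans/(_ sz_f).
rewrite !mevalX big_ord_recr /= mnmwiden_ordmax expr0 mulr1.
rewrite -{2}(subnK le_me) exprD -mulrA; congr (_ * _).
rewrite mdegE expr_sum -big_split /=; apply: eq_bigr => i _.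
by rewrite mnmwiden_widen -exprMn mulrC divfK.
Qed.

Definition homog_g (d : nat) (f : {mpoly R[n]}) : {mpoly R[n]} :=
  dehomogenize (psum_pos (even_deg d) (homogenize (even_deg d) f)).

Definition homog_h (d : nat) (f : {mpoly R[n]}) : {mpoly R[n]} :=
  dehomogenize (psum_neg (even_deg d) (homogenize (even_deg d) f)).

End Components.

Section Polyhedron.
Variables (R : realType) (n m r : nat).
Variables (a : 'I_m -> 'rV[R]_n) (b : 'I_m -> R).
Variables (p : 'I_r -> 'rV[R]_n) (q : 'I_r -> R).

Definition polyhedron : set 'rV[R]_n :=
  [set x | (forall i, dot (a i) x <= b i) /\ (forall j, dot (p j) x = q j)].

(* The minimum ratio tbar at the point y in the direction v. *)
Definition max_step (y v : 'rV[R]_n) : \bar R :=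
  \big[mine/+oo%E]_(i | 0 < dot (a i) v)
     ((b i - dot (a i) y) / dot (a i) v)%:E.

End Polyhedron.

Section Algorithm.
Variables (R : realType) (n : nat).

Definition feasible_directions (P : set 'rV[R]_n) (y : 'rV[R]_n) :
    set 'rV[R]_n :=
  [set v | exists2 delta : R, 0 < delta &
           forall t : R, 0 <= t <= delta -> P (y + t *: v)].

Definition argmin (P : set 'rV[R]_n) (F : 'rV[R]_n -> R) : set 'rV[R]_n :=
  [set y | P y /\ forall z, P z -> F y <= F z].

(* t is an allowed step size of the exact line search from y in direction v.
   The bound s <= tbar is vacuous when tbar is +oo. *)
Definition exact_search (f : {mpoly R[n]}) (tbar : \bar R) (y v : 'rV[R]_n)
    (t : R) : Prop :=
  if (0 < tbar)%E then
    [/\ 0 <= t, (t%:E <= tbar)%E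
      & forall s : R, 0 <= s -> (s%:E <= tbar)%E ->
          peval f (y + t *: v) <= peval f (y + s *: v)]
  else t = 0.

Variables (m r : nat).
Variables (a : 'I_m -> 'rV[R]_n) (b : 'I_m -> R).
Variables (p : 'I_r -> 'rV[R]_n) (q : 'I_r -> R).

(* x, y, t record a run that has reached iteration k and has computed y^k
   there: the stopping test failed at all the earlier iterations, it may or may
   not succeed at iteration k. The values x j, y j with j > k and t j with
   j >= k are irrelevant. *)
Record bdca_run (f g h : {mpoly R[n]}) (eps : R) (k : nat)
    (x y : nat -> 'rV[R]_n) (t : nat -> R) : Prop := BdcaRun {
  bdca_start : polyhedron a b p q (x 0%N);
  bdca_argmin : forall j, (j <= k)%N ->
    argmin (polyhedron a b p q)
      (fun z => peval g z - dot (grad h (x j)) z) (y j);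
  bdca_continue : forall j, (j < k)%N ->
    ~~ (norm2 (y j - x j) / (1 + norm2 (x j)) < eps);
  bdca_search : forall j, (j < k)%N ->
    exact_search f (max_step a b (y j) (y j - x j)) (y j) (y j - x j) (t j);
  bdca_next : forall j, (j < k)%N ->
    x j.+1 = y j + t j *: (y j - x j) }.

End Algorithm.

(* Main.v *)
Require Import Defs.
From mathcomp Require Import all_boot all_order all_algebra.
From mathcomp Require Import mpoly.
From mathcomp Require Import classical_sets reals constructive_ereal.

Set Implicit Arguments.
Unset Strict Implicit.
Unset Printing Implicit Defensive.

Import Order.TTheory GRing.Theory Num.Theory.

Local Open Scope classical_set_scope.
Local Open Scope ring_scope.

(** The ray y + s v, s >= 0, can leave the polyhedron only through the
    inequality constraints: an equality constraint that holds at y persists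
    along v as soon as v is orthogonal to its normal. An inequality i with
    <a_i, v> <= 0 persists as well, while one with <a_i, v> > 0 holds exactly
    up to s = (b_i - <a_i, y>) / <a_i, v>. Hence the feasible step sizes are
    exactly those between 0 and the minimum ratio [polyhedron_rayE], and all
    three claims are readings of this equivalence.

    For the algorithm, v = y^k - x^k is orthogonal to the normals p_j because
    both y^k and x^k are feasible. That y^k is feasible is part of its choice as
    a constrained minimizer; that x^k is feasible follows by induction, a new
    iterate being reached from the preceding y^j by a step of admissible size
    [bdca_iterate_feasible]. *)

Section Ray.
Variables (R : realType) (n m r : nat).
Variables (a : 'I_m -> 'rV[R]_n) (b : 'I_m -> R).
Variables (p : 'I_r -> 'rV[R]_n) (q : 'I_r -> R).

Local Notation P := (polyhedron a b p q).

Lemma dotDZr (u v w : 'rV[R]_n) (s : R) :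
  dot u (v + s *: w) = dot u v + s * dot u w.
Proof.
rewrite /dot mulr_sumr -big_split /=; apply: eq_bigr => i _.
by rewrite !mxE mulrDr mulrCA.
Qed.

Lemma dotBr (u v w : 'rV[R]_n) : dot u (v - w) = dot u v - dot u w.
Proof. by rewrite -scaleN1r dotDZr mulN1r. Qed.

Lemma le_max_step (y v : 'rV[R]_n) (s : R) :
  (s%:E <= max_step a b y v)%E <->
  forall i, 0 < dot (a i) v -> dot (a i) (y + s *: v) <= b i.
Proof.
have ratioE i : 0 < dot (a i) v ->
    (s%:E <= ((b i - dot (a i) y) / dot (a i) v)%:E)%E =
    (dot (a i) (y + s *: v) <= b i).
  by move=> av_gt0; rewrite lee_fin ler_pdivlMr // dotDZr lerBrDl.
split=> [/bigmin_geP[_ le_s] i av_gt0 | le_b].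
  by rewrite -ratioE // le_s.
apply/bigmin_geP; split=> [|i av_gt0]; first exact: leey.
by rewrite ratioE // le_b.
Qed.

Lemma polyhedron_sub_orthogonal (x y : 'rV[R]_n) :
  P x -> P y -> forall j, dot (p j) (y - x) = 0.
Proof. by move=> [_ px] [_ py] j; rewrite dotBr px py subrr. Qed.

(** Only the constraints with <a_i, v> > 0 restrict the step: the others hold
    at y and their left-hand sides do not increase along v. *)
Lemma polyhedron_rayE (y v : 'rV[R]_n) (s : R) :
  P y -> (forall j, dot (p j) v = 0) -> 0 <= s ->
  P (y + s *: v) <-> (s%:E <= max_step a b y v)%E.
Proof.
move=> [ay py] pv s_ge0; split=> [[asv _]|/le_max_step asv].
  by apply/le_max_step => i _; exact: asv.
split=> [i|j]; last by rewrite dotDZr pv mulr0 addr0.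
have [av_le0|] := leP (dot (a i) v) 0; last exact: asv.
by rewrite dotDZr -[leRHS]addr0 lerD // mulr_ge0_le0.
Qed.

Lemma max_step_ge0 (y v : 'rV[R]_n) : P y -> (0 <= max_step a b y v)%E.
Proof.
by move=> [ay _]; apply/le_max_step => i _; rewrite scale0r addr0.
Qed.

Lemma feasible_direction_max_step (y v : 'rV[R]_n) :
  P y -> (forall j, dot (p j) v = 0) ->
  feasible_directions P y v <-> (0 < max_step a b y v)%E.
Proof.
move=> Py pv; split=> [[delta delta_gt0 Pray]|step_gt0].
  have /(polyhedron_rayE Py pv (ltW delta_gt0)) : P (y + delta *: v).
    by apply: Pray; rewrite lexx ltW.
  by apply: lt_le_trans; rewrite lte_fin.
have [delta delta_gt0 le_delta] :
    exists2 delta : R, 0 < delta & (delta%:E <= max_step a b y v)%E.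
  case: (max_step a b y v) step_gt0 => [c c_gt0|_|//].
    by exists c; rewrite -?lte_fin.
  by exists 1; rewrite ?ltr01 ?leey.
exists delta => // s /andP[s_ge0 le_s].
by apply/(polyhedron_rayE Py pv s_ge0); apply: le_trans le_delta; rewrite lee_fin.
Qed.

End Ray.

Lemma bdca_iterate_feasible (R : realType) (n m r : nat)
    (a : 'I_m -> 'rV[R]_n) (b : 'I_m -> R)
    (p : 'I_r -> 'rV[R]_n) (q : 'I_r -> R) (f g h : {mpoly R[n]})
    (eps : R) (k : nat) (x y : nat -> 'rV[R]_n) (t : nat -> R) :
  bdca_run a b p q f g h eps k x y t ->
  forall j, (j <= k)%N -> polyhedron a b p q (x j).
Proof.
move=> [Px0 ymin _ search next]; elim=> [|j IHj] lt_jk //.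
have Px := IHj (ltnW lt_jk); have [Py _] := ymin j (ltnW lt_jk).
have := search j lt_jk; rewrite next // /exact_search.
case: ifP => [_ [t_ge0 le_t _]|_ ->]; last by rewrite scale0r addr0.
exact/(polyhedron_rayE Py (polyhedron_sub_orthogonal Px Py) t_ge0).
Qed.

Theorem lemma2 (R : realType) (n d m r : nat)
    (f g h : {mpoly R[n]})
    (a : 'I_m -> 'rV[R]_n) (b : 'I_m -> R)
    (p : 'I_r -> 'rV[R]_n) (q : 'I_r -> R)
    (eps : R) (x y : nat -> 'rV[R]_n) (t : nat -> R) (k : nat)
    (d_ge1 : (1 <= d)%N)
    (deg_f : msize f = d.+1)
    (P_nonempty : polyhedron a b p q !=set0)
    (f_bounded : exists c : R,
       forall z, polyhedron a b p q z -> c <= peval f z)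
    (gh_dc : (g = termwise_g d f /\ h = termwise_h d f) \/
             (g = homog_g d f /\ h = homog_h d f))
    (eps_gt0 : 0 < eps)
    (run : bdca_run a b p q f g h eps k x y t) :
  let dk := y k - x k in
  let tbar := max_step a b (y k) dk in
  (feasible_directions (polyhedron a b p q) (y k) dk <-> (0 < tbar)%E) /\
  (forall s : R, 0 <= s -> (s%:E <= tbar)%E ->
     polyhedron a b p q (y k + s *: dk)) /\
  (forall s : R, (tbar < s%:E)%E ->
     ~ polyhedron a b p q (y k + s *: dk)).
Proof.
move=> dk tbar.
have Px := bdca_iterate_feasible run (leqnn k).
have [Py _] := bdca_argmin run (leqnn k).
have pd := polyhedron_sub_orthogonal Px Py.
split; first exact: feasible_direction_max_step.
split=> [s s_ge0|s lt_s]; first by move/(polyhedron_rayE Py pd s_ge0).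
have s_ge0 : 0 <= s.
  by rewrite -lee_fin (le_trans (max_step_ge0 dk Py)) // ltW.
by move/(polyhedron_rayE Py pd s_ge0); rewrite leNgt lt_s.
Qed.
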